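(* Let $L$ be a leader holding an abstract being with representation $X_L\in\mathcal{V}_L$, and let $i\in\mathcal{C}_L(X_L)$, so that $T_{L\to i}(X_L)\neq0$. Let $x_i\in\mathcal{V}_i$ and $g_i\in\mathcal{V}_i$ be agent $i$'s current state and baseline goal, and write $M_i^{(0)}=g_i-x_i$ for the baseline motivational gradient. Consider a sequence of adoption steps $k=1,2,\dots$. At step $k$, agent $i$ holds a representation $X_i^{(k)}\in\mathcal{V}_i$ and updates its goal to $$g_i^{(k)}=g_i+\beta_i^{(k)}X_i^{(k)},\qquad \beta_i^{(k)}\in\mathbb{R},$$ with corresponding motivational gradient $$M_i^{(k)}=g_i^{(k)}-x_i=M_i^{(0)}+\beta_i^{(k)}X_i^{(k)}.$$ Assume that 1. $X_i^{(k)}\to T_{L\to i}(X_L)$ as $k\to\infty$, and 2. $\beta_i^{(k)}\to\infty$ as $k\to\infty$. Then $$\lim_{k\to\infty}\frac{M_i^{(k)}}{\|M_i^{(k)}\|}=\frac{T_{L\to i}(X_L)}{\|T_{L\to i}(X_L)\|}.$$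
   Context: Each agent $j$ has a value space $\mathcal{V}_j$, a finite-dimensional real vector space equipped with a norm $\|\cdot\|$. Agents are the nodes $V$ of a directed influence graph $G=(V,E)$; for each edge $(j,l)$ there is a linear interpretation map $T_{j\to l}:\mathcal{V}_j\to\mathcal{V}_l$. For a directed path $L=v_0\to\cdots\to v_k=i$ the composite interpretation map is $T_{L\rightsquigarrow i}=T_{v_{k-1}\to v_k}\circ\cdots\circ T_{v_0\to v_1}$. The leadership component is $\mathcal{C}_L(X_L)=\{i\in V:\text{ there is a directed path } L\rightsquigarrow i\text{ with } T_{L\rightsquigarrow i}(X_L)\neq 0\}$. In the claim, $T_{L\to i}:\mathcal{V}_L\to\mathcal{V}_i$ denotes the linear (composite) interpretation map from $L$ to $i$ along such a path, so $T_{L\to i}(X_L)\neq0$. *)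

(* Defs.v *)
From HB Require Import structures.
From mathcomp Require Import all_boot all_order all_algebra.
From mathcomp Require Import all_classical all_reals all_analysis.

Set Implicit Arguments.
Unset Strict Implicit.
Unset Printing Implicit Defensive.

Import Order.TTheory GRing.Theory Num.Theory.
Import numFieldNormedType.Exports.

Local Open Scope classical_set_scope.
Local Open Scope ring_scope.

(* Finite-dimensional real vector spaces with a norm. The norm is arbitrary:
   it is not tied to the coordinates of the [Vector] structure. *)
#[short(type="normedVectType")]
HB.structure Definition NormedVector (R : realType) :=
  {V of NormedModule R V & Vector R V}.

(* A directed path is any finite chain of consecutive edges. It may be empty
   (then its composite map is the identity) and it may revisit nodes. *)
Inductive dpath (A : Type) (E : rel A) (L : A) : A -> Type :=
| dpath_nil : dpath E L L
| dpath_rcons (j l : A) of dpath E L j & E j l : dpath E L l.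

Section Influence.
Variables (R : realType) (A : Type) (E : rel A) (V : A -> normedVectType R).
Variable T : forall j l : A, E j l -> {linear V j -> V l}.

Fixpoint composite (L i : A) (p : dpath E L i) : {linear V L -> V i} :=
  match p in dpath _ _ i return {linear V L -> V i} with
  | dpath_nil => idfun
  | dpath_rcons j l q e => T e \o composite q
  end.

Definition leadership_component (L : A) (XL : V L) : set A :=
  [set i | exists p : dpath E L i, composite p XL != 0].

End Influence.

Section Motivation.
Variables (R : realType) (W : normedVectType R).

(* Step 0 is the baseline, before any adoption; adoption steps are k >= 1. *)
Definition goal (g : W) (beta : nat -> R) (X : nat -> W) (k : nat) : W :=
  if k is 0%N then g else g + beta k *: X k.

Definition motivational_gradient (x : W) (gk : W) : W := gk - x.

Definition normalize (v : W) : W := `|v|^-1 *: v.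

End Motivation.

(* Main.v *)
(* Since [beta k] is eventually positive, [M k] and [M k / beta k] have the same
   normalization; the latter tends to the nonzero limit of [X k], where
   normalization is continuous. *)

Require Import Defs.
From mathcomp Require Import all_boot all_order all_algebra.
From mathcomp Require Import all_classical all_reals all_analysis.
Import Order.TTheory GRing.Theory Num.Theory.
Import numFieldNormedType.Exports.
Local Open Scope classical_set_scope.
Local Open Scope ring_scope.

(** Positive rescaling preserves direction, so [m + b t *: f t] may be replaced by
    [(b t)^-1 *: m + f t] once [b t] is positive. As [b] diverges the fixed offset [m] dies out and
    only the limit of [f] remains; [cvg_normalize] then passes to directions. The theorem is the
    case [m = g - x]. *)

Lemma normalizeZ {R : realType} {W : normedVectType R} {c : R} (v : W) :
  0 < c -> normalize (c *: v) = normalize v.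
Proof.
move=> c0; rewrite /normalize normrZ gtr0_norm// scalerA invfM mulrAC.
by rewrite mulVf ?mul1r// gt_eqF.
Qed.

(** Away from 0 the inverse of the norm is continuous, which is where [v != 0] enters. *)
Lemma cvg_normalize {R : realType} {W : normedVectType R} {T : Type}
    {F : set_system T} {FF : Filter F} {f : T -> W} {v : W} :
  v != 0 -> f t @[t --> F] --> v -> normalize (f t) @[t --> F] --> normalize v.
Proof.
move=> v0 fv; apply: cvgZ => //.
by apply: cvgV; [rewrite normr_eq0|exact: cvg_norm].
Qed.

Lemma cvg_normalize_pinfty {R : realType} {W : normedVectType R} {T : Type}
    {F : set_system T} {FF : ProperFilter F} {b : T -> R} {f : T -> W} (m : W)
    {v : W} :
  v != 0 -> b t @[t --> F] --> +oo -> f t @[t --> F] --> v ->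
  normalize (m + b t *: f t) @[t --> F] --> normalize v.
Proof.
move=> v0 boo fv.
have b0 : \forall t \near F, 0 < b t by exact: (cvgryPgt _).1 boo 0.
have bV : (b t)^-1 @[t --> F] --> (0 : R) by exact: (gtr0_cvgV0 b0).2 boo.
have mfv : (b t)^-1 *: m + f t @[t --> F] --> v.
  (* Write the limit as [0 *: m + v] to match the sum termwise. *)
  rewrite -[v]add0r -[X in X + v](scale0r m).
  by apply: cvgD => //; exact: cvgZr_tmp.
apply: cvg_trans (cvg_normalize v0 mfv); apply: near_eq_cvg.
near=> t.
have bt0 : 0 < b t by near: t.
rewrite -(normalizeZ ((b t)^-1 *: m + f t) bt0) scalerDr scalerA divff ?gt_eqF//.
by rewrite scale1r.
Unshelve. all: by end_near.
Qed.

Theorem theorem5 (R : realType) (A : Type) (E : rel A)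
    (V : A -> normedVectType R)
    (T : forall j l : A, E j l -> {linear V j -> V l})
    (L : A) (XL : V L)
    (i : A) (iC : leadership_component T XL i)
    (p : dpath E L i) (TXL_neq0 : composite T p XL != 0)
    (x g : V i) (beta : nat -> R) (X : nat -> V i)
    (cvgX : X k @[k --> \oo] --> composite T p XL)
    (cvgbeta : beta k @[k --> \oo] --> +oo) :
  normalize (motivational_gradient x (goal g beta X k)) @[k --> \oo]
    --> normalize (composite T p XL).
Proof.
apply: cvg_trans (cvg_normalize_pinfty (g - x) TXL_neq0 cvgbeta cvgX).
apply: near_eq_cvg; near=> k.
(* At [k = 0] the goal is the bare [g], so the formula for the gradient is used only for positive
   [k]. *)
have k0 : (0 < k)%N by near: k; exact: nbhs_infty_gt.
by rewrite -(prednK k0) /motivational_gradient /= addrAC.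
Unshelve. all: by end_near.
Qed.
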